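(* For positive integers $q,k\geq 1$, there is an algorithm that, given as input a $(q,2k)$-unbreakable graph $G$ on at least $(2q+2)^{2}(2q+2)!\,(k-1)^{2q+2}+1$ vertices, runs in time $(qk)^{\mathcal{O}(q)}\cdot n^{\mathcal{O}(1)}$ and either returns a minimal oct of $G$ of size at least $k$, or outputs an irrelevant vertex $v$ of $G$.
   Context: All graphs are finite, simple and undirected; $n=|V(G)|$. An oct of $G$ is a set $Z\subseteq V(G)$ with $G-Z$ bipartite; it is minimal if no proper subset is an oct. A vertex $v\in V(G)$ is irrelevant (for $k$) if $G$ has a minimal oct of size at least $k$ if and only if $G-v$ has a minimal oct of size at least $k$. A separation of $G$ is a pair $(X,Y)$ with $X\cup Y=V(G)$ and no edge between $X\setminus Y$ and $Y\setminus X$; its order is $|X\cap Y|$. $G$ is $(q,c)$-unbreakable if there is no separation of order at most $c$ with $|X\setminus Y|\geq q$ and $|Y\setminus X|\geq q$. *)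

(* Defs.v *)
From mathcomp Require Import all_boot.

Set Implicit Arguments.
Unset Strict Implicit.
Unset Printing Implicit Defensive.

Record sgraph (T : finType) := SGraph {
  edge :> rel T;
  edge_sym : symmetric edge;
  edge_irr : irreflexive edge
}.

Definition induced (T : finType) (G : sgraph T) (A : {set T}) :
    sgraph {x : T | x \in A} :=
  SGraph (edge := fun x y => G (val x) (val y))
    (fun x y => edge_sym G (val x) (val y))
    (fun x => edge_irr G (val x)).

Definition del (T : finType) (G : sgraph T) (Z : {set T}) := induced G (~: Z).

Definition bipartite (T : finType) (G : sgraph T) : Prop :=
  exists f : T -> bool, forall x y, G x y -> f x != f y.

Definition oct (T : finType) (G : sgraph T) (Z : {set T}) : Prop :=
  bipartite (del G Z).

Definition minimal_oct (T : finType) (G : sgraph T) (Z : {set T}) : Prop :=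
  oct G Z /\ forall Z' : {set T}, Z' \proper Z -> ~ oct G Z'.

Definition has_minimal_oct_geq (T : finType) (G : sgraph T) (k : nat) : Prop :=
  exists Z : {set T}, minimal_oct G Z /\ k <= #|Z|.

Definition irrelevant (T : finType) (G : sgraph T) (k : nat) (v : T) : Prop :=
  has_minimal_oct_geq G k <-> has_minimal_oct_geq (del G [set v]) k.

Definition separation (T : finType) (G : sgraph T) (X Y : {set T}) : Prop :=
  X :|: Y = [set: T] /\
  forall x y, x \in X :\: Y -> y \in Y :\: X -> ~~ G x y.

Definition unbreakable (T : finType) (G : sgraph T) (q c : nat) : Prop :=
  ~ exists X Y : {set T},
      [/\ separation G X Y, #|X :&: Y| <= c, q <= #|X :\: Y| & q <= #|Y :\: X|].

(* Algorithms are programs for a random access machine with structured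
   control flow.  The memory consists of arrays of natural numbers: [s a i] is
   cell [i] of array [a].  Array names are literals of the program, so a
   program uses finitely many arrays; indices are computed.  Every operation
   has unit cost.  There is deliberately no multiplication: with addition and
   (truncated) subtraction only, the numbers computed in [t] steps have at most
   [t] more bits than those in the input and the program, so the unit-cost
   measure is polynomially equivalent to Turing machine time. *)
Definition state := nat -> nat -> nat.

Inductive exp :=
| Lit of nat
| Get of nat & exp
| Add of exp & exp
| Sub of exp & exp.

Inductive cmd :=
| Skip
| Put of nat & exp & exp  (* [Put a i e] writes [e] to cell [i] of array [a] *)
| Seq of cmd & cmd
| If of exp & cmd & cmd   (* nonzero values are true *)
| While of exp & cmd.

Fixpoint eval (s : state) (e : exp) : nat :=
  match e with
  | Lit m => m
  | Get a i => s a (eval s i)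
  | Add e1 e2 => eval s e1 + eval s e2
  | Sub e1 e2 => eval s e1 - eval s e2
  end.

Fixpoint cost (e : exp) : nat :=
  match e with
  | Lit _ => 1
  | Get _ i => (cost i).+1
  | Add e1 e2 | Sub e1 e2 => (cost e1 + cost e2).+1
  end.

Definition upd (s : state) (a i m : nat) : state :=
  fun b j => if (b == a) && (j == i) then m else s b j.

(* [exec c s t s']: started in [s], [c] halts after [t] steps in [s']. *)
Inductive exec : cmd -> state -> nat -> state -> Prop :=
| ExecSkip s : exec Skip s 1 s
| ExecPut s a i e :
    exec (Put a i e) s (cost i + cost e).+1 (upd s a (eval s i) (eval s e))
| ExecSeq s s1 s2 c1 c2 t1 t2 :
    exec c1 s t1 s1 -> exec c2 s1 t2 s2 -> exec (Seq c1 c2) s (t1 + t2) s2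
| ExecIfTrue s s1 e c1 c2 t :
    eval s e != 0 -> exec c1 s t s1 -> exec (If e c1 c2) s (cost e + t).+1 s1
| ExecIfFalse s s1 e c1 c2 t :
    eval s e = 0 -> exec c2 s t s1 -> exec (If e c1 c2) s (cost e + t).+1 s1
| ExecWhileTrue s s1 s2 e c t1 t2 :
    eval s e != 0 -> exec c s t1 s1 -> exec (While e c) s1 t2 s2 ->
    exec (While e c) s (cost e + t1 + t2).+1 s2
| ExecWhileFalse s e c :
    eval s e = 0 -> exec (While e c) s (cost e).+1 s.

Lemma exec_det c s t s1 t' s1' :
  exec c s t s1 -> exec c s t' s1' -> t = t' /\ s1 = s1'.
Proof.
move=> H; elim: H t' s1' => {c s t s1};
  intros; match goal with H : exec _ _ ?t ?s' |- _ = ?t /\ _ => inversion H end;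
  subst=> //;
  repeat match goal with
  | H : is_true (?x != 0), H' : ?x = 0 |- _ => by rewrite H' in H
  | IH : (forall t s, exec ?c ?s0 t s -> _), H : exec ?c ?s0 _ _ |- _ =>
      case: (IH _ _ H) => *; subst; clear H
  end; by [].
Qed.

(* Row-major adjacency matrix: cell [x * n + y] is 1 iff [x] and [y] are
   adjacent. *)
Definition adj_array (n : nat) (G : sgraph 'I_n) (i : nat) : nat :=
  [exists x : 'I_n, exists y : 'I_n, (i == x * n + y) && G x y].

(* Array 0 starts with [q], [k], [n]; array 1 is the adjacency matrix; all
   other cells are 0. *)
Definition input (q k n : nat) (G : sgraph 'I_n) : state :=
  fun a i =>
    match a with
    | 0 => nth 0 [:: q; k; n] i
    | 1 => adj_array G i
    | _ => 0
    end.

(* A final state with [s 0 0 = 1] returns the vertex set whose characteristic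
   vector is array 2; one with [s 0 0 = 0] returns the vertex [s 0 1]. *)
Definition returns_set (n : nat) (s : state) (Z : {set 'I_n}) : Prop :=
  s 0 0 = 1 /\ Z = [set i : 'I_n | s 2 i != 0].

Definition returns_vertex (n : nat) (s : state) (v : 'I_n) : Prop :=
  s 0 0 = 0 /\ s 0 1 = v.

(* Main.v *)
(* The algorithm grows a tree of vertex sequences.  For a node [p] it completes
   [p] greedily to a maximal induced bipartite subgraph; the complement is a
   minimal oct [Z], which is disjoint from [p] if [p] induces a bipartite graph.
   If [#|Z| >= k] it is returned; otherwise every [z] in [Z] is marked and, when
   [size p <= 2q], gives a child [z :: p].  The tree has at most
   [1 + (2q+1) (k-1)^(2q+1) <= n] nodes, so some vertex [v] stays unmarked and
   the whole computation is polynomial in [n] alone.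

   An unmarked [v] is irrelevant.  Otherwise some minimal oct [W] of size at most
   [k] contains [v], and the bipartite graph [G - W] has a path [P] joining two
   neighbours of [v] that lie in different colour classes.  Let [E] consist of
   the first [q] and the last [q] vertices of [P].  An oct [Z] of size less than
   [k] that avoids both [v] and [E] yields two 2-colourings of [G - (W u Z)]; the
   sets where they agree and disagree form, with [W u Z], a separation of order
   less than [2k] whose two sides contain the two parts of [E], contradicting
   unbreakability.  So the oct of every node meets [E], and one descends in the
   tree through [2q + 1] distinct vertices of [E], although [#|E| <= 2q]. *)

From mathcomp Require Import all_boot zify.
Require Import Defs.

Set Implicit Arguments.
Unset Strict Implicit.
Unset Printing Implicit Defensive.

(** * Bipartite induced subgraphs and minimal octs *)

Section Bipartite.
Variables (T : finType) (G : sgraph T).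
Implicit Types (A B K W Z : {set T}) (v x y z : T) (p : seq T).

Definition proper2 B (f : T -> bool) := {in B &, forall x y, G x y -> f x != f y}.

(** Quantifying over finite functions makes the property decidable, as [maxset] and the test in
    [add_bip] require. *)
Definition bip B : bool :=
  [exists f : {ffun T -> bool},
     [forall x in B, forall y in B, G x y ==> (f x != f y)]].

Lemma bipP B : reflect (exists f, proper2 B f) (bip B).
Proof.
apply: (iffP existsP) => [[f /forall_inP Hf]|[f Hf]].
  exists f => x y xB yB Gxy.
  by move/forall_inP: (Hf x xB) => /(_ y yB) /implyP /(_ Gxy).
exists [ffun x => f x]; apply/forall_inP => x xB; apply/forall_inP => y yB.
by apply/implyP => Gxy; rewrite !ffunE; apply: Hf.
Qed.

Lemma bipS A B : A \subset B -> bip B -> bip A.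
Proof.
move=> /subsetP sAB /bipP [f Hf]; apply/bipP; exists f => x y xA yA.
by apply: Hf; apply: sAB.
Qed.

Lemma bip0 : bip set0.
Proof. by apply/bipP; exists (fun=> true) => x y; rewrite inE. Qed.

End Bipartite.

Lemma bip_induced (T : finType) (G : sgraph T) (A : {set T})
    (B : {set {x : T | x \in A}}) : bip (induced G A) B = bip G (val @: B).
Proof.
apply/bipP/bipP => [[f Hf]|[f Hf]]; last first.
  by exists (f \o val) => x y xB yB; apply: Hf; apply: imset_f.
exists (fun x => if insub x is Some u then f u else true) => x y.
move=> /imsetP [x' x'B ->] /imsetP [y' y'B ->]; rewrite !valK; exact: Hf.
Qed.

Lemma bip_setT (T : finType) (G : sgraph T) : bip G [set: T] <-> bipartite G.
Proof.
split=> [/bipP [f Hf]|[f Hf]]; first by exists f => x y; apply: Hf; rewrite inE.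
by apply/bipP; exists f => x y _ _; apply: Hf.
Qed.

Lemma val_setT (T : finType) (A : {set T}) :
  val @: [set: {x : T | x \in A}] = A.
Proof.
apply/setP => x; apply/imsetP/idP => [[u _ ->]|xA]; first exact: valP.
by exists (eqtype.Sub x xA); rewrite ?SubK ?inE.
Qed.

Section Oct.
Variables (T : finType) (G : sgraph T).
Implicit Types (A B K W Z : {set T}) (v x y z : T) (p : seq T).

Lemma octE Z : oct G Z <-> bip G (~: Z).
Proof. by rewrite /oct -bip_setT bip_induced val_setT. Qed.

(** Supersets of octs are octs, so minimality only has to be tested by putting back one vertex at a
    time. *)
Lemma minimal_octE Z :
  minimal_oct G Z <->
  bip G (~: Z) /\ {in Z, forall z, ~~ bip G (z |: ~: Z)}.
Proof.
split=> [[/octE oZ minZ]|[bZ minZ]].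
  split=> // z zZ; apply/negP => bz; apply: (minZ (Z :\ z)); first exact: properD1.
  by apply/octE; rewrite setCD setUC.
split; first exact/octE.
move=> Z' /properP [sZ' [z zZ zZ']] /octE bZ'.
apply/negP/negPn: (minZ z zZ); apply: bipS bZ'.
by rewrite subUset sub1set inE zZ' setCS.
Qed.

End Oct.

Section LargeOct.
Variables (T : finType) (G : sgraph T).
Implicit Types (A B K W Z : {set T}) (v x y z : T) (p : seq T).

(** Serves to compare minimal octs of [G] and of [G - v] as subsets of the same type [T]. *)
Lemma has_minimal_oct_induced A k :
  has_minimal_oct_geq (induced G A) k <->
  exists Z, [/\ Z \subset A, bip G (A :\: Z),
    {in Z, forall z, ~~ bip G (z |: (A :\: Z))} & k <= #|Z|].
Proof.
have valC (Z : {set {x : T | x \in A}}) : val @: (~: Z) = A :\: (val @: Z).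
  apply/setP => x; rewrite inE; apply/imsetP/andP => [[u uZ ->]|[xZ xA]].
    split; last exact: valP.
    by rewrite mem_imset ?inE in uZ *; last exact: val_inj.
  exists (eqtype.Sub x xA); last by rewrite SubK.
  by rewrite inE; apply: contra xZ => xZ; apply/imsetP; exists (eqtype.Sub x xA).
split=> [[Z [/minimal_octE [bZ minZ] kZ]]|[Z [sZA bZ minZ kZ]]].
  exists (val @: Z); split.
  - by apply/subsetP => _ /imsetP [u _ ->]; apply: valP.
  - by rewrite -valC -bip_induced.
  - move=> _ /imsetP [u uZ ->]; rewrite -valC -imset_set1 -imsetU -bip_induced.
    exact: minZ.
  - by rewrite card_imset //; exact: val_inj.
pose Z' : {set {x : T | x \in A}} := [set u | val u \in Z].
have eZ : val @: Z' = Z.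
  apply/setP => x; apply/imsetP/idP => [[u]|xZ]; first by rewrite inE => ? ->.
  by exists (eqtype.Sub x (subsetP sZA _ xZ)); rewrite ?inE SubK.
exists Z'; split; last by rewrite -(card_imset _ val_inj) eZ.
apply/minimal_octE; split; first by rewrite bip_induced valC eZ.
move=> u; rewrite inE => uZ.
by rewrite bip_induced imsetU imset_set1 valC eZ; apply: minZ.
Qed.

Lemma minimal_oct_exists A B : bip G B -> B \subset A ->
  exists Z, [/\ Z \subset A :\: B, bip G (A :\: Z) &
    {in Z, forall z, ~~ bip G (z |: (A :\: Z))}].
Proof.
move=> bB sBA.
pose P C := [&& bip G C, B \subset C & C \subset A].
have PB : P B by rewrite /P bB subxx.
have [M /maxsetP [/and3P [bM sBM sMA] maxM] _] := maxset_exists PB.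
exists (A :\: M); rewrite setDDr setDv set0U (setIidPr sMA); split=> //.
  exact: setDS.
move=> z; rewrite inE => /andP [zM zA]; apply: contra zM => bz.
rewrite -(maxM (z |: M)) ?setU11 ?subsetUr // /P bz subUset sMA sub1set zA.
by rewrite (subset_trans sBM) ?subsetUr.
Qed.

(** * A criterion for irrelevance *)

(** A minimal oct of one graph yields one of the other by deleting [v], shrinking, or adding [v].
    The first two may lower the size, and the hypothesis prevents it from falling below [k]. *)
Lemma irrelevantP k v :
  (forall W, minimal_oct G W -> v \in W -> k < #|W|) -> irrelevant G k v.
Proof.
move=> Hv; rewrite /irrelevant /del has_minimal_oct_induced.
split=> [[Z [mZ kZ]]|[Z [sZ bZ mZ kZ]]].
  have /minimal_octE [bZ minZ] := mZ.
  have [vZ|vZ] := boolP (v \in Z).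
    have kZ' := Hv _ mZ vZ.
    have eZ : ~: [set v] :\: (Z :\ v) = ~: Z.
      by apply/setP => x; rewrite !inE; case: eqVneq => [->|_]; rewrite ?vZ ?andbT.
    exists (Z :\ v); rewrite eZ; split=> //.
    - by apply/subsetP => x; rewrite !inE => /andP [].
    - by move=> z; rewrite inE => /andP [_]; apply: minZ.
    - by have := cardsD1 v Z; rewrite vZ; lia.
  (* Here [Z] avoids [v] and is shrunk to a minimal oct [Z1] of [G - v]. If [Z1] had fewer than [k]
     vertices, it would be a proper subset of [Z], hence no oct of [G], and [v |: Z1] would be a
     minimal oct of [G] of size at most [k]. *)
  have [||Z1 [sZ1 bZ1 minZ1]] := @minimal_oct_exists (~: [set v]) (~: Z :\ v).
  - exact: bipS (subsetDl _ _) bZ.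
  - by apply/subsetP => x; rewrite !inE => /andP [].
  have {}sZ1 : Z1 \subset Z :\ v.
    apply: subset_trans sZ1 _; apply/subsetP => x; rewrite !inE.
    by case: (x == v); rewrite //= andbT negbK.
  have sZ1Z := subset_trans sZ1 (subsetDl _ _).
  have vZ1 : v \notin Z1 by apply: contra vZ; apply: (subsetP sZ1Z).
  have [kZ1|Z1k] := leqP k #|Z1|.
    exists Z1; split=> //; apply/subsetP => x xZ1; have := subsetP sZ1 _ xZ1.
    by rewrite !inE => /andP [].
  have eZ1 : ~: (v |: Z1) = ~: [set v] :\: Z1.
    by apply/setP => x; rewrite !inE negb_or andbC.
  suff : k < #|v |: Z1| by rewrite cardsU1 vZ1; lia.
  apply: Hv; last exact: setU11.
  apply/minimal_octE; rewrite eZ1; split=> // z; rewrite in_setU1.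
  case/predU1P => [->|]; last exact: minZ1.
  apply/negP => bv.
  have [y yZ yZ1] : exists2 y, y \in Z & y \notin Z1.
    have : ~~ (Z \subset Z1) by apply/negP => /subset_leq_card; lia.
    by move/subsetPn.
  apply/negP/negPn: (minZ y yZ); apply: bipS bv; apply/subsetP => x.
  rewrite !inE; case: (eqVneq x v) => //= xv; rewrite andbT => /orP [/eqP -> //|].
  by apply: contra; apply: (subsetP sZ1Z).
(* For the converse, either [Z] is still an oct of [G], and then a minimal one, or [v |: Z] is a
   minimal oct. *)
have vZ : v \notin Z.
  by apply/negP => /(subsetP sZ); rewrite !inE eqxx.
have [bv|bv] := boolP (bip G (v |: (~: [set v] :\: Z))).
  have eZ : v |: (~: [set v] :\: Z) = ~: Z.
    by apply/setP => x; rewrite !inE; case: eqVneq => [->|_]; rewrite ?vZ ?andbT.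
  exists Z; split=> //; apply/minimal_octE; rewrite -eZ; split=> // z zZ.
  apply/negP => bz; apply/negP/negPn: (mZ z zZ); apply: bipS bz.
  by rewrite setUS ?subsetUr.
exists (v |: Z); rewrite cardsU1 vZ; split; last by lia.
have eZ : ~: (v |: Z) = ~: [set v] :\: Z.
  by apply/setP => x; rewrite !inE negb_or andbC.
apply/minimal_octE; rewrite eZ; split=> // z; rewrite in_setU1.
by case/predU1P => [->|]; [|apply: mZ].
Qed.

(** * Bichromatic paths and unbreakability *)

(** If no component of [G[B]] contained neighbours of [v] of both colours, swapping colours in some
    components would make all neighbours of [v] equal in colour and leave the other colour for
    [v]. *)
Lemma bichromatic_path B v f : proper2 G B f -> v \notin B -> ~~ bip G (v |: B) ->
  exists a p, [/\ path G a p, uniq (a :: p), {subset a :: p <= B},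
    G v a && G v (last a p) & f a != f (last a p)].
Proof.
move=> Hf vB nb.
pose e := [rel x y | [&& x \in B, y \in B & G x y]].
have esym : connect_sym e.
  by apply: sym_connect_sym => x y /=; rewrite edge_sym andbCA.
case: (boolP [exists a, exists b, [&& a \in B, b \in B, G v a, G v b, connect e a b & f a != f b]]).
  case/existsP => a /existsP [b /and5P [aB bB va vb /andP [/connectP [p]]]].
  case/shortenP => p' ep' up' _ eb; rewrite eb in vb * => fab.
  exists a, p'; split=> //; last by rewrite va.
    by apply: sub_path ep' => x y /and3P [].
  move=> x; rewrite inE => /predU1P [-> //|].
  elim: p' a aB {va vb fab up' b bB eb} ep' => //= y p' IH a _ /andP [/and3P [_ yB _] ep'].
  by rewrite inE => /predU1P [-> //|]; apply: IH ep'.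
move=> nab; case/negP: nb; apply/bipP.
(* [flip] selects the components containing a neighbour of [v] coloured [false]; after the swap all
   neighbours are [true], and [v] becomes [false]. *)
pose flip x := [exists a, [&& a \in B, G v a, connect e a x & ~~ f a]].
exists (fun x => (x != v) && (f x (+) flip x)).
have flipe x y : e x y -> flip x = flip y.
  move=> exy; apply: eq_existsb => a; congr [&& _, _, _ & _].
  by apply: same_connect_r => //; apply: connect1.
have nbr x : x \in B -> G v x -> f x (+) flip x.
  move=> xB vx; case: (boolP (flip x)) => [/existsP [a /and4P [aB va ax fa]]|].
    case: (boolP (f x)) => // fx; case/negP: nab; apply/existsP; exists a.
    by apply/existsP; exists x; rewrite aB xB va vx ax fx (negPf fa).
  rewrite addbF; apply: contraR => fx; apply/existsP; exists x.
  by rewrite xB vx connect0 fx.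
have ne x : x \in B -> x != v by apply: contraTneq => ->.
move=> x y; rewrite !in_setU1 => /predU1P [->|xB] /predU1P [->|yB] Gxy.
- by rewrite edge_irr in Gxy.
- by rewrite eqxx (ne y) // (nbr y).
- by rewrite eqxx (ne x) // nbr // edge_sym.
- rewrite (ne x) // (ne y) //= (flipe x y) /= ?xB ?yB //.
  by have := Hf _ _ xB yB Gxy; case: (f x); case: (f y); case: (flip y).
Qed.

(* Colour [B = ~: W] by [f] and [~: Z] by [g].  On [B :\: Z] the sum of both
   colourings is constant along edges, hence its two level sets are separated
   by [W :|: Z]; the ends of the path, being neighbours of [v], have the same
   [g]-colour and thus lie in different level sets. *)
Lemma oct_hits_path_ends q k v W Z f a p :
    unbreakable G q (2 * k) -> #|W| <= k -> #|Z| <= k -> v \notin Z ->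
    bip G (~: Z) -> proper2 G (~: W) f ->
    path G a p -> uniq (a :: p) -> {subset a :: p <= ~: W} ->
    G v a && G v (last a p) -> f a != f (last a p) ->
  exists2 z, z \in Z & z \in take q (a :: p) ++ rev (take q (rev (a :: p))).
Proof.
move=> unbr Wk Zk vZ /bipP [g Hg] Hf ap up sp /andP [va vl] fal.
apply/exists_inP; apply: contraT => /exists_inPn nZ.
pose h x := f x (+) g x.
pose S := W :|: Z.
have hedge x y : x \notin S -> y \notin S -> G x y -> h x = h y.
  rewrite !inE !negb_or => /andP [xW xZ] /andP [yW yZ] Gxy.
  have := Hf x y; have := Hg x y; rewrite !inE => /(_ xZ yZ Gxy) + /(_ xW yW Gxy).
  by rewrite /h; case: (f x); case: (f y); case: (g x); case: (g y).
have hpath b r : path G b r -> {in b :: r, forall x, x \notin S} ->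
    {in b :: r, forall x, h x = h b}.
  elim: r b => [|y r IH] b /=; first by move=> _ _ x; rewrite inE => /eqP ->.
  case/andP => Gby ey nS x; rewrite inE => /predU1P [-> //|xr].
  rewrite (hedge b y) ?nS ?inE ?eqxx ?orbT //; apply: IH => // z zr.
  by apply: nS; rewrite inE zr orbT.
have pS x : x \in a :: p -> x \notin Z -> x \notin S.
  by move=> /sp; rewrite !inE negb_or => -> ->.
have take1 : {in take q (a :: p), forall x, x \notin S}.
  move=> x xt; apply: pS; first exact: mem_take xt.
  by apply/negP => /nZ; rewrite mem_cat xt.
have take2 : {in take q (rev (a :: p)), forall x, x \notin S}.
  move=> x xt; apply: pS; first by rewrite -mem_rev; apply: mem_take xt.
  by apply/negP => /nZ; rewrite mem_cat mem_rev xt orbT.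
(* For [q = 0] the trivial separation already contradicts unbreakability. From here on [q.+1]
   replaces [q], so both end segments are nonempty. *)
case: q unbr nZ take1 take2 => [|q] unbr nZ take1 take2.
  case: unbr; exists setT, set0.
  split; rewrite ?setI0 ?cards0 //; split; first by rewrite setU0.
  by move=> x y _; rewrite !inE.
have h1 : {in take q.+1 (a :: p), forall x, h x = h a}.
  by rewrite /=; apply: hpath; [apply: take_path|].
have h2 : {in take q.+1 (rev (a :: p)), forall x, h x = h (last a p)}.
  have : rev (a :: p) = last a p :: rev (belast a p).
    by rewrite lastI rev_rcons.
  move=> er; rewrite er /=; apply: hpath; last by move: take2; rewrite er.
  apply: take_path; rewrite rev_path (eq_path (e' := G)) // => x y.
  exact: edge_sym.
have ala : a \in take q.+1 (a :: p) by rewrite inE eqxx.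
have lal : last a p \in take q.+1 (rev (a :: p)).
  by rewrite lastI rev_rcons /= inE eqxx.
have hal : h a != h (last a p).
  have := take1 _ ala; have := take2 _ lal; rewrite !inE !negb_or.
  move=> /andP [_ lZ] /andP [_ aZ].
  have := Hg v a; have := Hg v (last a p); rewrite !inE => /(_ vZ lZ vl) + /(_ vZ aZ va).
  by move: fal; rewrite /h; case: (f a); case: (f (last a p)); case: (g v);
    case: (g a); case: (g (last a p)).
(* A shorter path would lie within its own first segment, giving both its ends the same
   [h]-value. *)
have qp : q < size (a :: p).
  rewrite ltnNge; apply/negP => qp; move/eqP: hal; apply.
  by symmetry; apply: h1; rewrite take_oversize ?mem_last // ltnW.
case: unbr; exists (S :|: [set x | h x == h a]), (S :|: [set x | h x != h a]).
have hS (r : seq T) (X : {set T}) : uniq r -> q < size r ->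
    {in take q.+1 r, forall x, x \in X} -> q < #|X|.
  move=> ur qr HX; have <- : size (take q.+1 r) = q.+1 by rewrite size_takel.
  rewrite -(card_uniqP (take_uniq _ ur)); apply: subset_leq_card.
  by apply/subsetP.
split.
- split; first by apply/setP => x; rewrite !inE orbACA orbN !orbT.
  move=> x y; rewrite !inE; case: (boolP (x \in W)) => //= xW.
  case: (boolP (x \in Z)) => //= xZ; case: (boolP (y \in W)) => //= yW.
  case: (boolP (y \in Z)) => //= yZ; rewrite negbK => /andP [_ /eqP hx].
  case/andP => _ hy; apply: contra hy => Gxy.
  by rewrite -hx; apply/eqP/esym/hedge; rewrite ?inE ?negb_or ?xW ?xZ ?yW ?yZ.
- have -> : (S :|: [set x | h x == h a]) :&: (S :|: [set x | h x != h a]) = S.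
    by apply/setP => x; rewrite !inE; case: (_ == _); rewrite /= ?orbF ?orbT ?andbT.
  by have := cardsUI W Z; rewrite -/S; lia.
- apply: (hS (a :: p)) => // x xt.
  by have := take1 _ xt; rewrite in_setD !in_setU !in_set (h1 _ xt) eqxx /= orbF orbT andbT.
- apply: (hS (rev (a :: p))); rewrite ?rev_uniq ?size_rev // => x xt.
  have := take2 _ xt; rewrite in_setD !in_setU !in_set (h2 _ xt) eq_sym (negPf hal) /=.
  by rewrite orbF orbT andbT.
Qed.

(** * Greedy completion to a maximal bipartite set *)

Definition add_bip B v := if bip G (v |: B) then v |: B else B.

(** The vertices of [p] come first, so that they are all kept if [p] induces a bipartite graph; the
    pass over all of [T] makes the result maximal. *)
Definition greedy p : {set T} := foldl add_bip set0 (p ++ enum T).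

Lemma bip_foldl_add B p : bip G B -> bip G (foldl add_bip B p).
Proof.
by elim: p B => //= v p IH B bB; apply: IH; rewrite /add_bip; case: ifP.
Qed.

Lemma sub_foldl_add B p : B \subset foldl add_bip B p.
Proof.
elim: p B => //= v p IH B; apply: subset_trans (IH _); rewrite /add_bip.
by case: ifP => // _; apply: subsetUr.
Qed.

(** [K] certifies that no vertex of [p] is rejected, because the sets built along [p] stay inside
    [K]. *)
Lemma foldl_add_sub B p K : bip G K -> B \subset K -> {subset p <= K} ->
  {subset p <= foldl add_bip B p}.
Proof.
move=> bK; elim: p B => //= v p IH B sBK sp x.
have vBK : v |: B \subset K.
  by rewrite subUset sBK sub1set sp // inE eqxx.
have eadd : add_bip B v = v |: B by rewrite /add_bip (bipS vBK).
rewrite eadd inE => /predU1P [->|].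
  by apply: (subsetP (sub_foldl_add _ _)); rewrite setU11.
by apply: IH => // y yp; apply: sp; rewrite inE yp orbT.
Qed.

(** The set only grows, so a vertex rejected once can never be added later. *)
Lemma foldl_add_maximal B p v : v \in p ->
  v \notin foldl add_bip B p -> ~~ bip G (v |: foldl add_bip B p).
Proof.
elim: p B => //= u p IH B; rewrite inE => /predU1P [<-|] nv; last exact: IH.
move: nv; apply: contra => bv.
apply: (subsetP (sub_foldl_add _ _)); rewrite /add_bip.
rewrite ifT ?setU11 //; apply: bipS bv; apply: setUS.
by apply: subset_trans (sub_foldl_add _ p); rewrite /add_bip; case: ifP; rewrite ?subsetUr.
Qed.

Lemma greedy_bip p : bip G (greedy p).
Proof. by apply: bip_foldl_add; apply: bip0. Qed.

Lemma greedy_minimal_oct p : minimal_oct G (~: greedy p).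
Proof.
apply/minimal_octE; rewrite setCK; split; first exact: greedy_bip.
move=> z; rewrite inE => zp; apply: foldl_add_maximal => //.
by rewrite mem_cat mem_enum orbT.
Qed.

Lemma sub_greedy p K : bip G K -> {subset p <= K} -> {subset p <= greedy p}.
Proof.
move=> bK sp x xp; rewrite /greedy foldl_cat.
apply: (subsetP (sub_foldl_add _ _)).
by apply: (@foldl_add_sub _ _ K) xp; rewrite ?sub0set.
Qed.

(** * Irrelevance of untouched vertices *)

(** [L] stands for the set of tree nodes. Closure under children is asked only up to depth [2q],
    since a node made of [2q + 1] distinct vertices of [E] is already contradictory. *)
Lemma untouched_irrelevant q k v (L : seq (seq T)) :
    unbreakable G q (2 * k) -> [::] \in L ->
    (forall p, p \in L -> size p <= 2 * q ->
       [/\ #|~: greedy p| < k, v \in greedy p &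
           {in ~: greedy p, forall z, z :: p \in L}]) ->
  irrelevant G k v.
Proof.
move=> unbr L0 Lcl; apply: irrelevantP => W /minimal_octE [bW minW] vW.
rewrite ltnNge; apply/negP => Wk.
have [f Hf] := bipP _ _ bW.
have [|||a [p [ap up sp va fa]]] := @bichromatic_path (~: W) v f => //.
- by rewrite inE vW.
- exact: minW.
set E := take q (a :: p) ++ rev (take q (rev (a :: p))).
have sE : {subset E <= ~: W}.
  by move=> x; rewrite mem_cat mem_rev => /orP [] /mem_take; rewrite ?mem_rev; apply: sp.
have Esz : size E <= 2 * q.
  by rewrite mul2n -addnn size_cat size_rev !size_take_min leq_add ?geq_minl.
suff [r [rL sr ur rE]] : exists r : seq T, [/\ r \in L, size r = (2 * q).+1, uniq r & {subset r <= E}].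
  by have /leq_trans/(_ Esz) := uniq_leq_size ur rE; rewrite sr ltnn.
have : (2 * q).+1 <= (2 * q).+1 by [].
elim: {1 3}(2 * q).+1 => [|j IH] jq; first by exists [::].
have [|r [rL sr ur rE]] := IH; first exact: ltnW.
have [|rk vr rcl] := Lcl r rL; first by rewrite sr.
have [||z zr zE] := @oct_hits_path_ends q k v W (~: greedy r) f a p unbr Wk (ltnW rk) _ _ Hf ap up sp va fa.
- by rewrite inE vr.
- by rewrite setCK greedy_bip.
exists (z :: r); split.
- exact: rcl.
- by rewrite /= sr.
(* [r] lies in the bipartite graph [G - W], so its greedy completion contains it and [z] is a new
   vertex. *)
- rewrite /= ur andbT; apply: contraL zr => zr; rewrite inE negbK.
  by apply: sub_greedy bW _ _ zr => x /rE /sE.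
- by move=> x; rewrite inE => /predU1P [->|/rE].
Qed.

End LargeOct.

(** * Time-bounded weakest preconditions *)

(** Total correctness: halting is included, while [t] is only an upper bound that may be rounded
    up. *)
Definition wp (c : cmd) (s : state) (t : nat) (Q : state -> Prop) :=
  exists t' s', [/\ exec c s t' s', t' <= t & Q s'].

Lemma wp_le c s t t' (Q : state -> Prop) : wp c s t Q -> t <= t' -> wp c s t' Q.
Proof. by move=> [u [s' [Hs ut HQ]]] tt'; exists u, s'; split=> //; lia. Qed.

Lemma wp_conseq c s t (Q Q' : state -> Prop) :
  wp c s t Q -> (forall s', Q s' -> Q' s') -> wp c s t Q'.
Proof. by move=> [u [s' [Hs ut HQ]]] QQ'; exists u, s'; split=> //; apply: QQ'. Qed.

Lemma wp_skip s t (Q : state -> Prop) : 0 < t -> Q s -> wp Skip s t Q.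
Proof. by move=> t0 HQ; exists 1, s; split=> //; constructor. Qed.

Lemma wp_put a i e s t (Q : state -> Prop) :
  cost i + cost e < t -> Q (upd s a (eval s i) (eval s e)) -> wp (Put a i e) s t Q.
Proof.
by move=> Ht HQ; eexists; eexists; split; [constructor| |exact: HQ].
Qed.

Lemma wp_seq t1 t2 c1 c2 s t (Q : state -> Prop) :
  t1 + t2 <= t -> wp c1 s t1 (fun s1 => wp c2 s1 t2 Q) -> wp (Seq c1 c2) s t Q.
Proof.
move=> Ht [u1 [s1 [H1 ut1 [u2 [s2 [H2 ut2 HQ]]]]]].
exists (u1 + u2), s2; split=> //; last by lia.
exact: ExecSeq H1 H2.
Qed.

Lemma wp_put_seq t' a i e c s t (Q : state -> Prop) :
  (cost i + cost e).+1 + t' <= t -> wp c (upd s a (eval s i) (eval s e)) t' Q ->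
  wp (Seq (Put a i e) c) s t Q.
Proof. by move=> Ht HQ; apply: wp_seq Ht _; apply: wp_put. Qed.

Lemma wp_if t' e c1 c2 s t (Q : state -> Prop) :
  (cost e + t').+1 <= t ->
  (eval s e != 0 -> wp c1 s t' Q) -> (eval s e = 0 -> wp c2 s t' Q) ->
  wp (If e c1 c2) s t Q.
Proof.
move=> Ht H1 H2; case: (eqVneq (eval s e) 0) => He.
  have [u [s' [Hs ut HQ]]] := H2 He.
  by exists (cost e + u).+1, s'; split=> //; [apply: ExecIfFalse | lia].
have [u [s' [Hs ut HQ]]] := H1 He.
by exists (cost e + u).+1, s'; split=> //; [apply: ExecIfTrue | lia].
Qed.

(** The number carried by [I] is a strictly decreasing variant: at most [m] rounds and [m.+1]
    evaluations of the guard. *)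
Lemma wp_while (I : nat -> state -> Prop) t' m e c s t (Q : state -> Prop) :
  m.+1 * (cost e + t').+1 <= t -> I m s ->
  (forall m s, I m s -> eval s e != 0 -> exists2 m', m' < m & wp c s t' (I m')) ->
  (forall m s, I m s -> eval s e = 0 -> Q s) ->
  wp (While e c) s t Q.
Proof.
move=> Ht Im Hbody Hend; apply: wp_le Ht.
elim/ltn_ind: m s Im => m IH s Im; case: (eqVneq (eval s e) 0) => He.
  exists (cost e).+1, s; split; [exact: ExecWhileFalse| |exact: Hend Im He].
  by rewrite (leq_trans _ (leq_pmull _ _)) // ltnS leq_addr.
have [m' m'm [u1 [s1 [H1 ut1 HQ]]]] := Hbody _ _ Im He.
have [u2 [s2 [H2 ut2 HQ2]]] := IH _ m'm _ HQ.
exists (cost e + u1 + u2).+1, s2; split=> //; first exact: ExecWhileTrue H1 H2.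
have : m'.+1 * (cost e + t').+1 <= m * (cost e + t').+1 by rewrite leq_mul2r m'm orbT.
by rewrite (mulSn m); lia.
Qed.

Local Notation Reg r := (Get r (Lit 0)) (only parsing).
Local Notation SetReg r e := (Put r (Lit 0) e) (only parsing).

Definition For (r : nat) (e : exp) (c : cmd) : cmd :=
  Seq (SetReg r (Lit 0))
    (While (Sub e (Reg r)) (Seq c (SetReg r (Add (Reg r) (Lit 1))))).

(** The bound [e] is evaluated anew before each round, so the invariant has to determine it. The
    increment is built into the rule; the body must leave the counter in place. *)
Lemma wp_for (I : nat -> state -> Prop) N t' r e c s t (Q : state -> Prop) :
  N.+1 * (cost e + t' + 20) <= t -> I 0 (upd s r 0 0) ->
  (forall j s, I j s -> eval s e = N /\ s r 0 = j) ->
  (forall j s, j < N -> I j s ->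
     wp c s t' (fun s' => s' r 0 = j /\ I j.+1 (upd s' r 0 j.+1))) ->
  (forall s, I N s -> Q s) ->
  wp (For r e c) s t Q.
Proof.
move=> Ht I0 Ie Ic IN.
apply: (@wp_put_seq (N.+1 * (cost e + t' + 17))).
  by apply: leq_trans Ht; rewrite /= !(mulSn N) !mulnDr; lia.
pose J m s := exists j, [/\ m = N - j, j <= N & I j s].
apply: (@wp_while J (t' + 6) N) => /=.
- by rewrite leq_mul2l; apply/orP; right; lia.
- by exists 0; rewrite subn0.
- move=> m s1 [j [-> jN Ij]]; have [-> ->] := Ie _ _ Ij => ne.
  have {}jN : j < N by lia.
  exists (N - j.+1); first by lia.
  apply: (@wp_seq t' 6) => //; apply: wp_conseq (Ic _ _ jN Ij) _ => s' [s'j Is'].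
  by apply: wp_put => //=; exists j.+1; split=> //; rewrite s'j addn1.
- move=> m s1 [j [_ jN Ij]]; have [-> ->] := Ie _ _ Ij => eN; apply: IN.
  by have -> : N = j by lia.
Qed.

Lemma updE s a i m b j :
  upd s a i m b j = if (b == a) && (j == i) then m else s b j.
Proof. by []. Qed.

Lemma ltS_eqVlt i j : (i < j.+1) = (i == j) || (i < j).
Proof. exact: leq_eqVlt. Qed.

(** [l] lists the arrays that may have changed; changes are tracked by whole arrays. *)
Definition frame (l : seq nat) (s s' : state) :=
  forall a i, a \notin l -> s' a i = s a i.

Lemma frame_upd l s s' a i m : a \in l -> frame l s s' -> frame l s (upd s' a i m).
Proof.
by move=> al F b j bl; rewrite /upd -F //; case: eqVneq bl al => // -> /negPf ->.
Qed.

Lemma frame_trans l1 l2 l s s1 s2 : frame l1 s s1 -> frame l2 s1 s2 ->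
  {subset l1 <= l} -> {subset l2 <= l} -> frame l s s2.
Proof.
move=> F1 F2 sl1 sl2 a i al; rewrite F2 ?F1 //; apply: contra al; [exact: sl1|exact: sl2].
Qed.

(* Scalar variables are cells 0 of arrays of their own.  [out] is the
   characteristic vector of the current candidate oct, [rep] the labelling used
   by the bipartiteness test, and [vert], [par], [dep] give the last vertex, the
   parent and the depth of each tree node. *)
Local Notation N := (Get 0 (Lit 2)) (only parsing).
Local Notation adj := 1 (only parsing).
Local Notation out := 2 (only parsing).
Local Notation rep := 3 (only parsing).
Local Notation vert := 4 (only parsing).
Local Notation par := 5 (only parsing).
Local Notation dep := 6 (only parsing).
Local Notation mark := 7 (only parsing).
Local Notation rw := 8 (only parsing).
Local Notation rx := 9 (only parsing).
Local Notation ry := 10 (only parsing).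
Local Notation rbase := 11 (only parsing).
Local Notation ra := 12 (only parsing).
Local Notation rb := 13 (only parsing).
Local Notation rok := 14 (only parsing).
Local Notation rcur := 15 (only parsing).
Local Notation rnode := 16 (only parsing).
Local Notation rv := 17 (only parsing).
Local Notation rcnt := 18 (only parsing).
Local Notation rhead := 19 (only parsing).
Local Notation rtail := 20 (only parsing).

Definition Neq e1 e2 := Add (Sub e1 e2) (Sub e2 e1).

Lemma eval_Neq s e1 e2 : (eval s (Neq e1 e2) == 0) = (eval s e1 == eval s e2).
Proof. by rewrite /=; lia. Qed.

(** * The bipartiteness test *)

(** Joins the class of [(y,1)] to that of [(x,0)] by relabelling. Both labels are copied first
    because the loop overwrites [rep]. *)
Definition merge_cmd :=
  Seq (SetReg ra (Get rep (Reg rx)))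
 (Seq (SetReg rb (Get rep (Add N (Reg ry))))
 (For rw (Add N N)
    (If (Neq (Get rep (Reg rw)) (Reg rb)) Skip (Put rep (Reg rw) (Reg ra))))).

(** [rbase] holds [x n], updated by addition as the machine cannot multiply. The guard vanishes
    exactly for edges between kept vertices. *)
Definition scan_cmd :=
  For rx N
   (Seq
     (For ry N
       (If (Add (Add (Get out (Reg rx)) (Get out (Reg ry)))
                (Sub (Lit 1) (Get adj (Add (Reg rbase) (Reg ry)))))
           Skip merge_cmd))
     (SetReg rbase (Add (Reg rbase) N))).

(** A graph is bipartite iff no vertex is connected to its own copy in the bipartite double cover;
    [rep] computes the components of that cover. *)
Definition test_cmd :=
  Seq (For rw (Add N N) (Put rep (Reg rw) (Reg rw)))
 (Seq (SetReg rbase (Lit 0))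
 (Seq scan_cmd
 (Seq (SetReg rok (Lit 1))
 (For rx N
   (If (Get out (Reg rx)) Skip
   (If (Neq (Get rep (Reg rx)) (Get rep (Add N (Reg rx)))) Skip
     (SetReg rok (Lit 0)))))))).

Lemma wp_merge n x y s : s 0 2 = n -> s rx 0 = x -> s ry 0 = y ->
  wp merge_cmd s (100 * n.+1) (fun s' => frame [:: rep; rw; ra; rb] s s' /\
    forall u, u < n + n ->
      s' rep u = if s rep u == s rep (n + y) then s rep x else s rep u).
Proof.
move=> sn sx sy.
apply: (@wp_put_seq (100 * n.+1 - 10)) => /=; first by lia.
apply: (@wp_put_seq (100 * n.+1 - 30)) => /=; first by lia.
rewrite ?updE /= sx sy sn.
apply: (@wp_for (fun j s' => [/\ frame [:: rep; rw; ra; rb] s s', s' rw 0 = j,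
  s' ra 0 = s rep x, s' rb 0 = s rep (n + y) &
  forall u, s' rep u = if (u < j) && (s rep u == s rep (n + y)) then s rep x else s rep u])
  (n + n) 20) => /=.
- by lia.
- by split=> //; do 3 apply: frame_upd => //.
- by move=> j s' [F sj _ _ _]; rewrite (F 0 2) // sn.
- move=> j s' jn [F sj sa sb sr]; apply: (@wp_if 5) => //.
    rewrite eval_Neq /= sj sb sr ltnn /= => ne; apply: wp_skip => //; split=> //.
    split=> //; first exact: frame_upd.
    move=> u; rewrite ?updE /= sr ltS_eqVlt; case: (eqVneq u j) => [->|] //=.
    by rewrite (negPf ne) ltnn.
  move/eqP; rewrite eval_Neq /= sj sb sr ltnn /= => e.
  apply: wp_put => //=; split; first by rewrite ?updE.
  split=> //; first by do 2 apply: frame_upd => //.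
  move=> u; rewrite ?updE /= sj sa sr ltS_eqVlt.
  by case: (eqVneq u j) => [->|] //=; rewrite e.
- by move=> s' [F _ _ _ sr]; split=> // u un; rewrite sr un.
Qed.

Section Scan.
Variables (n : nat) (z a : nat -> nat).
Implicit Types (f : nat -> bool) (r : nat -> nat).

Definition link x y := [&& z x == 0, z y == 0 & a (x * n + y) != 0].

Definition coloring f := forall x y, x < n -> y < n -> link x y -> f x != f y.

(** A colouring lifted to the double cover: the copies of a vertex get opposite colours, so an edge
    [xy] joins [(x,0)] to a [(y,1)] of equal colour. *)
Definition lift2 f w := if w < n then f w else ~~ f (w - n).

(* The labels [0 .. 2n-1] stand for the vertices [(x,0)] and [(x,1)] of the
   bipartite double cover, in this order. *)
Definition sound r := forall f, coloring f -> forall w w', w < n + n -> w' < n + n ->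
  r w = r w' -> lift2 f w = lift2 f w'.

Definition joined (P : nat -> nat -> bool) r := forall x y, x < n -> y < n ->
  link x y -> P x y -> r x = r (n + y).

(** Every colouring gives [(x,0)] and [(y,1)] equal lifted colours when [xy] is an edge, so their
    classes may be merged. *)
Lemma sound_merge r r' x y : x < n -> y < n -> link x y -> sound r ->
  (forall u, u < n + n -> r' u = if r u == r (n + y) then r x else r u) ->
  sound r'.
Proof.
move=> xn yn lxy sr er f gf.
have fxy : lift2 f (n + y) = lift2 f x.
  rewrite /lift2 xn ltnNge leq_addr /= addKn.
  by have := gf _ _ xn yn lxy; case: (f x); case: (f y).
have x2 : x < n + n by lia.
have y2 : n + y < n + n by lia.
move=> w w' wn w'n; rewrite !er //.
case: eqP => ew; case: eqP => ew'.
- by move=> _; apply: sr; rewrite ?ew ?ew'.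
- by move=> e; rewrite (sr f gf w (n + y)) // fxy; apply: sr.
- by move=> e; rewrite (sr f gf w' (n + y)) // fxy; apply: sr.
- exact: sr.
Qed.

Lemma joined_merge P r r' x y : x < n -> y < n -> joined P r ->
  (forall u, u < n + n -> r' u = if r u == r (n + y) then r x else r u) ->
  joined (fun x' y' => P x' y' || (x' == x) && (y' == y)) r'.
Proof.
move=> xn yn jr er x' y' x'n y'n l'.
rewrite !er; try lia; case/orP => [/(jr x' y' x'n y'n l') -> //|].
by case/andP => /eqP -> /eqP ->; rewrite eqxx; case: ifP.
Qed.

Lemma joined_sub (P P' : nat -> nat -> bool) r : joined P r ->
  (forall x y, x < n -> y < n -> link x y -> P' x y -> P x y) -> joined P' r.
Proof. by move=> jr PP' x y xn yn lxy /PP' Pxy; apply: jr => //; apply: Pxy. Qed.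

(** The pairs already handled when the row-major scan reaches [(x, y)]. *)
Definition before x y x' y' := (x' < x) || (x' == x) && (y' < y).

Definition scan_frame := [:: rep; rw; ra; rb; rx; ry; rbase].

Lemma wp_scan s : s 0 2 = n -> s adj =1 a -> s out =1 z -> s rbase 0 = 0 ->
  (forall w, w < n + n -> s rep w = w) ->
  wp scan_cmd s (300 * (n.+1 * n.+1 * n.+1)) (fun s' =>
    [/\ frame scan_frame s s', sound (s' rep) & joined (fun _ _ => true) (s' rep)]).
Proof.
move=> sn sa sz sb sr.
pose inv x y s' := [/\ frame scan_frame s s', s' rbase 0 = x * n,
  sound (s' rep) & joined (before x y) (s' rep)].
have inv_upd x y s' b m : b \in [:: rx; ry] -> inv x y s' -> inv x y (upd s' b 0 m).
  rewrite !inE => bxy [F eb ? ?]; split=> //.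
  - by apply: frame_upd => //; rewrite !inE; case/orP: bxy => ->; rewrite ?orbT.
  - by rewrite ?updE; case/orP: bxy => /eqP ->.
  - by rewrite /upd; case/orP: bxy => /eqP ->.
  - by rewrite /upd; case/orP: bxy => /eqP ->.
apply: (@wp_for (fun x s' => s' rx 0 = x /\ inv x 0 s') n
  (200 * (n.+1 * n.+1) + 10)) => /=.
- by nia.
- split=> //; apply: inv_upd => //; split=> //.
    by move=> f _ w w' wn w'n; rewrite !sr // => ->.
  by move=> x y _ _ _; rewrite /before ltn0 andbF.
- by move=> x s' [sx [F _ _ _]]; rewrite (F 0 2).
- move=> x s1 xn [sx ix].
  apply: (@wp_seq (200 * (n.+1 * n.+1)) 10) => //.
  apply: (@wp_for (fun y s' => [/\ s' ry 0 = y, s' rx 0 = x & inv x y s']) n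
    (100 * n.+1 + 20)) => /=.
  + by nia.
  + by split=> //; apply: inv_upd.
  + by move=> y s' [sy _ [F _ _ _]]; rewrite (F 0 2).
  + move=> y s2 yn [sy sx2 iy].
    have [F eb so jo] := iy.
    apply: (@wp_if (100 * n.+1)); first by rewrite /=; lia.
      rewrite /= sx2 sy eb !(F 1) // !(F 2) // sa !sz => nl.
      apply: wp_skip => //; split=> //; split=> //.
      apply: inv_upd => //; split=> //; apply: joined_sub jo _ => x' y' _ _ l'.
      rewrite /before ltS_eqVlt; case: (x' < x) => //=.
      case/andP => /eqP ex; rewrite ex eqxx; case/orP => [/eqP ey|->] //.
      by move: l' nl; rewrite /link ex ey; lia.
    rewrite /= sx2 sy eb !(F 1) // !(F 2) // sa !sz => nl.
    have l' : link x y by rewrite /link; lia.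
    have := @wp_merge n x y s2; rewrite (F 0 2) // => /(_ sn sx2 sy) Hm.
    apply: wp_conseq Hm _ => s3 [F3 er]; split; first by rewrite F3.
    split=> //; first by rewrite ?updE /= F3.
    apply: inv_upd => //; split.
    * by apply: frame_trans F F3 _ _ => // b; rewrite !inE; lia.
    * by rewrite F3.
    * exact: sound_merge er.
    * apply: joined_sub (joined_merge xn yn jo er) _ => x' y' _ _ _.
      rewrite /before ltS_eqVlt; case: (x' < x) => //=.
      by case: (x' == x) => //=; rewrite orbC.
  + move=> s2 [sy sx2 [F eb so jo]]; apply: wp_put => //=; split.
      by rewrite ?updE /=.
    split=> //; apply: inv_upd => //; split=> //.
    * exact: frame_upd.
    * by rewrite ?updE /= eb (F 0 2) // sn mulSn addnC.
    * apply: joined_sub jo _ => x' y' _ y'n _.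
      by rewrite /before ltS_eqVlt ltn0 andbF orbF y'n andbT orbC.
- move=> s' [_ [F _ so jo]]; split=> //.
  by apply: joined_sub jo _ => x y xn _ _ _; rewrite /before xn.
Qed.

Lemma wp_test s : s 0 2 = n -> s adj =1 a -> s out =1 z ->
  (forall x y, x < n -> y < n -> link x y -> link y x) ->
  wp test_cmd s (1000 * (n.+1 * n.+1 * n.+1)) (fun s' =>
    [/\ frame (rok :: scan_frame) s s',
     s' rok 0 <> 0 -> exists f, coloring f & s' rok 0 = 0 -> forall f, ~ coloring f]).
Proof.
move=> sn sa sz lsym.
have n3 : n.+1 <= n.+1 * n.+1 * n.+1 by nia.
apply: (@wp_seq (100 * n.+1) (1000 * (n.+1 * n.+1 * n.+1) - 100 * n.+1)); first by lia.
apply: (@wp_for (fun j s' => [/\ frame (rok :: scan_frame) s s', s' rw 0 = j &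
   forall w, w < j -> s' rep w = w]) (n + n) 10) => /=.
- by lia.
- by split=> //; apply: frame_upd.
- by move=> j s' [F sj _]; rewrite (F 0 2) // sn.
- move=> j s' jn [F sj er]; apply: wp_put => //=; split; first by rewrite ?updE.
  split=> //; first by do 2 apply: frame_upd => //.
  by move=> w; rewrite ?updE /= sj ltS_eqVlt; case: eqP => [//|_] /er.
move=> s1 [F1 _ er].
apply: (@wp_put_seq (1000 * (n.+1 * n.+1 * n.+1) - 100 * n.+1 - 10)) => /=; first by lia.
apply: (@wp_seq (300 * (n.+1 * n.+1 * n.+1)) (500 * (n.+1 * n.+1 * n.+1))); first by lia.
set s2 := upd _ _ _ _.
have F2 : frame (rok :: scan_frame) s s2 by apply: frame_upd.
have sub_scan : {subset scan_frame <= rok :: scan_frame}.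
  by move=> b; move=> bs; rewrite in_cons bs orbT.
apply: wp_conseq (@wp_scan s2 _ _ _ _ _) _ => //; first by rewrite (F2 0 2).
- by move=> i; rewrite (F2 1) ?sa.
- by move=> i; rewrite (F2 2) ?sz.
move=> s3 [F3 so jo].
have {F2}F3 : frame (rok :: scan_frame) s s3 by apply: frame_trans F2 F3 _ _.
apply: (@wp_put_seq (100 * n.+1)) => /=; first by lia.
apply: (@wp_for (fun j s' => [/\ frame (rok :: scan_frame) s s', s' rx 0 = j,
   forall i, s' rep i = s3 rep i &
   if s' rok 0 == 0 then exists x, [/\ x < n, z x = 0 & s3 rep x = s3 rep (n + x)]
   else forall x, x < j -> z x = 0 -> s3 rep x <> s3 rep (n + x)]) n 40) => /=.
- by lia.
- by split=> //; do 2 apply: frame_upd => //.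
- by move=> j s' [F sj _ _]; rewrite (F 0 2).
- move=> j s' jn [F sj e3 Hok].
  apply: (@wp_if 30) => //=; rewrite sj (F 2) // sz => zj.
    apply: wp_skip => //; split=> //; split=> //; first exact: frame_upd.
    rewrite ?updE /=; case: ifP Hok => // _ Hok x.
    by rewrite ltS_eqVlt => /predU1P [->|/Hok //]; lia.
  apply: (@wp_if 5) => //.
    rewrite eval_Neq /= sj (F 0 2) // sn !e3 => ne.
    apply: wp_skip => //; split=> //; split=> //; first exact: frame_upd.
    rewrite ?updE /=; case: ifP Hok => // _ Hok x.
    by rewrite ltS_eqVlt => /predU1P [->|/Hok //] _; apply/eqP.
  move/eqP; rewrite eval_Neq /= sj (F 0 2) // sn !e3 => /eqP e.
  apply: wp_put => //=; split; first by rewrite ?updE.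
  split=> //; first by do 2 apply: frame_upd => //.
  by rewrite ?updE /=; exists j.
- move=> s' [F _ _ Hok]; split=> //.
    move/eqP/negPf => ne; rewrite ne in Hok.
    (* An edge [xy] makes the label pair of [y] the swapped label pair of [x]. *)
    exists (fun x => s3 rep x < s3 rep (n + x)) => x y xn yn lxy.
    rewrite (jo x y) // -(jo y x) //; last exact: lsym.
    have : z y = 0 by case/and3P: lxy => _ /eqP.
    by move/(Hok y yn); lia.
  (* Soundness would force equal lifted colours on [x] and its copy, but these are [f x] and its
     negation. *)
  move=> e0 f gf; rewrite e0 eqxx in Hok; case: Hok => x [xn _].
  have nx : (n + x < n) = false by lia.
  move=> e; have := so f gf x (n + x) _ _ e.
  rewrite /lift2 xn nx addKn => H; have := H _ _.
  by case: (f x) => H'; have := H' ltac:(lia) ltac:(lia).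
Qed.
End Scan.

Lemma adj_arrayE n (G : sgraph 'I_n) (x y : 'I_n) :
  adj_array G (x * n + y) = G x y.
Proof.
congr nat_of_bool; apply/existsP/idP => [[x' /existsP [y' /andP [/eqP e Gxy]]]|Gxy].
  have n0 : 0 < n by apply: leq_ltn_trans (ltn_ord x).
  have ex : x = x'.
    by apply: val_inj; have := congr1 (divn^~ n) e; rewrite /= !divnMDl // !divn_small ?addn0.
  have ey : y = y'.
    by apply: val_inj; have := congr1 (modn^~ n) e; rewrite /= !modnMDl !modn_small.
  by rewrite ex ey.
by exists x; apply/existsP; exists y; rewrite eqxx.
Qed.

Section Greedy.
Variables (n : nat) (G : sgraph 'I_n).
Implicit Types (s : state) (L : seq (seq 'I_n)).

Let m := n.+1.

Definition kept s : {set 'I_n} := [set i : 'I_n | s out i == 0].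

Definition loaded s := s 0 2 = n /\ s adj =1 adj_array G.

Lemma loaded_frame l s s' : frame l s s' -> 0 \notin l -> 1 \notin l ->
  loaded s -> loaded s'.
Proof. by move=> F l0 l1 [sn sa]; split=> [|i]; rewrite F. Qed.

Lemma linkE (z : nat -> nat) (x y : 'I_n) :
  link n z (adj_array G) x y = [&& z x == 0, z y == 0 & G x y].
Proof. by rewrite /link adj_arrayE eqb0 negbK. Qed.

Lemma coloringP (z : nat -> nat) :
  (exists f, coloring n z (adj_array G) f) <-> bip G [set i : 'I_n | z i == 0].
Proof.
split=> [[f Hf]|/bipP [f Hf]].
  apply/bipP; exists (f \o val) => x y; rewrite !inE => zx zy Gxy.
  by have := Hf x y (ltn_ord x) (ltn_ord y); rewrite linkE zx zy; apply.
exists (fun i => if insub i is Some x then f x else true) => x y xn yn.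
rewrite !insubT -[x in link _ _ _ x]/(val (Ordinal xn)) -[y in link _ _ _ _ y]/(val (Ordinal yn)).
by rewrite linkE => /and3P [zx zy]; apply: Hf; rewrite inE.
Qed.

(** * Greedy minimal octs *)

(** [out] describes the complement: writing 0 adds the vertex tentatively, and a failed test takes
    it out again. *)
Definition try_cmd :=
  Seq (Put out (Reg rcur) (Lit 0))
 (Seq test_cmd (If (Reg rok) Skip (Put out (Reg rcur) (Lit 1)))).

Definition try_frame := [:: out, rok & scan_frame].

Lemma kept_upd s (v : 'I_n) c :
  kept (upd s out v c) = if c == 0 then v |: kept s else kept s :\ v.
Proof.
apply/setP => x; have ev : (x == v :> nat) = (x == v) by [].
by case: (eqVneq c 0) => [->|/negPf c0]; rewrite !inE ?updE /= ev;
  case: (x == v); rewrite //= c0.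
Qed.

Lemma kept_ext s s' : s' out =1 s out -> kept s' = kept s.
Proof. by move=> e; apply/setP => x; rewrite !inE e. Qed.

Lemma wp_try s (v : 'I_n) : loaded s -> s rcur 0 = v -> bip G (kept s) ->
  (forall i, i < n -> s out i <= 1) ->
  wp try_cmd s (1100 * (m * m * m)) (fun s' =>
    [/\ frame try_frame s s', kept s' = add_bip G (kept s) v & forall i, i < n -> s' out i <= 1]).
Proof.
move=> ls sv bs s1.
have m3 : 1 <= m * m * m by rewrite /m; nia.
apply: (@wp_put_seq (1050 * (m * m * m))) => /=; first by lia.
set s0 := upd _ _ _ _.
have F0 : frame try_frame s s0 by apply: frame_upd.
have [s0n s0a] := loaded_frame F0 isT isT ls.
have d0 u : u < n -> s0 out u <= 1.
  by move=> un; rewrite /s0 updE; case: ifP => // _; apply: s1.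
have k0 : kept s0 = v |: kept s by rewrite /s0 sv kept_upd.
apply: (@wp_seq (1000 * (m * m * m)) 20); first by lia.
apply: wp_conseq (@wp_test n (s0 out) (adj_array G) s0 s0n s0a _ _) _ => //.
  move=> x y xn yn; rewrite -[x]/(val (Ordinal xn)) -[y]/(val (Ordinal yn)).
  by rewrite !linkE edge_sym andbCA.
move=> s2 [F2 ok1 ok0].
have {}F2d : s2 out =1 s0 out by move=> i; apply: F2.
have F : frame try_frame s s2.
  apply: frame_trans F0 F2 _ _ => // b bs'.
  by rewrite /try_frame in_cons bs' orbT.
apply: (@wp_if 10) => //= e.
  apply: wp_skip => //; split=> //; last first.
    by move=> i i_n; rewrite F2d d0.
  rewrite (kept_ext F2d) k0 /add_bip ifT //.
  have /coloringP : exists f, coloring n (s0 out) (adj_array G) f by apply/ok1/eqP.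
  by rewrite -/(kept s0) k0.
have nb : bip G (v |: kept s) = false.
  apply/negbTE; rewrite -k0; apply/negP => bk.
  by have [f] := (coloringP (s0 out)).2 bk; apply: ok0.
have ecur : s2 rcur 0 = v by rewrite F.
apply: wp_put => //=; split; first exact: frame_upd.
  (* [v] was not kept before, as otherwise adding it would have left a bipartite set; hence removing
     it restores [kept s]. *)
  rewrite ecur kept_upd /= (kept_ext F2d) k0 /add_bip nb setU1K //.
  by apply: contraFN nb => vk; rewrite (setUidPr _) // sub1set.
by move=> i i_n; rewrite updE; case: ifP => // _; rewrite F2d d0.
Qed.

(** The walk to the root meets the entries of the node's sequence from its head onwards, and stops
    at the root, which is node 0. *)
Definition greedy_cmd :=
  Seq (For rv N (Put out (Reg rv) (Lit 1)))
 (Seq (SetReg rnode (Reg rhead))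
 (Seq (While (Reg rnode)
        (Seq (SetReg rcur (Get vert (Reg rnode)))
        (Seq try_cmd
             (SetReg rnode (Get par (Reg rnode))))))
 (Seq (For rv N (Seq (SetReg rcur (Reg rv)) try_cmd))
 (Seq (SetReg rcnt (Lit 0))
      (For rv N (SetReg rcnt (Add (Reg rcnt) (Get out (Reg rv))))))))).

Definition greedy_frame := [:: rcur, rnode, rv, rcnt & try_frame].

(* Row [j] of [L] is the list of labels on the path from the node [j] to the root. *)
Definition tree s L :=
  [/\ nth [::] L 0 = [::],
   forall j, j < size L -> s dep j = size (nth [::] L j) &
   forall j, 0 < j < size L -> s par j < j /\
     exists2 v : 'I_n, s vert j = v & nth [::] L j = v :: nth [::] L (s par j)].

Lemma tree_frame l s s' L : frame l s s' ->
  vert \notin l -> par \notin l -> dep \notin l -> tree s L -> tree s' L.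
Proof.
move=> F lv lp ld [L0 Ld Lp]; split=> // j jL; first by rewrite F ?Ld.
by rewrite !F //; apply: Lp.
Qed.

Lemma sub_try_greedy : {subset try_frame <= greedy_frame}.
Proof. by move=> b bs; rewrite /greedy_frame 4!in_cons bs !orbT. Qed.

Lemma wp_greedy s L i : loaded s -> tree s L -> s rhead 0 = i -> i < size L ->
  i <= n ->
  wp greedy_cmd s (4000 * (m * m * m * m)) (fun s' =>
    [/\ frame greedy_frame s s', kept s' = greedy G (nth [::] L i) &
        s' rcnt 0 = #|~: greedy G (nth [::] L i)|]).
Proof.
move=> ls tL si iL i_n.
have m4 : m <= m * m * m * m by rewrite /m; nia.
have m3 : 1 <= m * m * m by rewrite /m; nia.
set p := nth [::] L i.
apply: (@wp_seq (100 * m) (3900 * (m * m * m * m))); first by lia.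
apply: (@wp_for (fun j s' => [/\ frame greedy_frame s s', s' rv 0 = j &
   forall u, u < j -> s' out u = 1]) n 20) => /=.
- by rewrite -/m; lia.
- by split=> //; apply: frame_upd.
- by move=> j s' [F sj _]; have [-> _] := loaded_frame F isT isT ls.
- move=> j s' jn [F sj s1]; apply: wp_put => //=; split; first by rewrite ?updE.
  split=> //; first by do 2 apply: frame_upd => //.
  by move=> u; rewrite ?updE /= sj ltS_eqVlt; case: eqP => //= _ /s1.
move=> s1 [F1 _ d1].
apply: (@wp_put_seq (3900 * (m * m * m * m) - 10)) => /=; first by lia.
apply: (@wp_seq (1300 * (m * m * m * m)) (2600 * (m * m * m * m) - 10)); first by lia.
pose step p1 s' := [/\ frame greedy_frame s s', kept s' = foldl (add_bip G) set0 p1 &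
  forall u, u < n -> s' out u <= 1].
have step_try p1 (v : 'I_n) s' : step p1 s' -> s' rcur 0 = v ->
    wp try_cmd s' (1100 * (m * m * m)) (fun s'' => frame try_frame s' s'' /\
      step (rcons p1 v) s'').
  move=> [F ek s'1] cv.
  have ls' := loaded_frame F isT isT ls.
  have bk : bip G (kept s') by rewrite ek; apply: bip_foldl_add; apply: bip0.
  apply: wp_conseq (wp_try ls' cv bk s'1) _ => s'' [F' ek' s''1]; split=> //.
  split=> //; last by rewrite ek' ek -cats1 foldl_cat.
  by apply: frame_trans F F' _ _ => //; apply: sub_try_greedy.
have step_upd p1 s' r c : r \in [:: rcur; rnode; rv; rcnt] -> step p1 s' ->
    step p1 (upd s' r 0 c).
  rewrite !inE => re [F ek s'1].
  have rd : (out == r) = false by lia.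
  split.
  - apply: frame_upd F; rewrite !inE; lia.
  - by rewrite -ek; apply: kept_ext => u; rewrite ?updE rd.
  - by move=> u un; rewrite ?updE rd; apply: s'1.
(* Parents have smaller indices, so the node index is the variant. [p1] is the part of [p] already
   tried, and the row of [j] is the rest. *)
apply: (@wp_while (fun j s' => s' rnode 0 = j /\ exists p1, [/\ step p1 s', j <= i &
    p = p1 ++ nth [::] L j]) (1100 * (m * m * m) + 20) i) => /=.
- by rewrite /m; nia.
- split; first by rewrite ?updE /= F1.
  exists [::]; split=> //; apply: step_upd => //; split=> //.
    by apply/setP => x; rewrite !inE d1.
  by move=> u un; rewrite d1.
- move=> j s2 [sj [p1 [st ji ep]]]; rewrite sj -lt0n => j0.
  have [F ek s21] := st.
  have [L0 Ld /(_ j)] := tree_frame F isT isT isT tL.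
  rewrite j0 (leq_ltn_trans ji iL) => /(_ isT) [pj [v sv eL]].
  exists (s2 par j) => //.
  apply: (@wp_put_seq (1100 * (m * m * m) + 10)) => /=; first by lia.
  apply: (@wp_seq (1100 * (m * m * m)) 10); first by lia.
  apply: wp_conseq (@step_try p1 v _ _ _) _.
  - exact: step_upd.
  - by rewrite ?updE /= sj.
  move=> s3 [F3 st3]; apply: wp_put => //=.
  have -> : s3 par (s3 rnode 0) = s2 par j by rewrite !F3 // ?updE /= sj.
  split; first by rewrite ?updE.
  exists (rcons p1 v); split; first exact: step_upd.
    by rewrite (leq_trans (ltnW pj)).
  by rewrite ep eL cat_rcons.
move=> j0 s2 [sj0 [p1 [st _ ep]]] e0; rewrite e0 in sj0.
have {}ep : p = p1 by rewrite ep -sj0; have [-> _ _] := tL; rewrite cats0.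
rewrite {}ep in st *.
apply: (@wp_seq (1300 * (m * m * m * m)) (100 * m + 20)); first by lia.
apply: (@wp_for (fun j s' => s' rv 0 = j /\ step (p1 ++ take j (enum 'I_n)) s') n
  (1100 * (m * m * m) + 10)) => /=.
- by rewrite -/m; nia.
- by split; [rewrite ?updE | rewrite take0 cats0; apply: step_upd].
- by move=> j s' [sj [F _ _]]; have [-> _] := loaded_frame F isT isT ls.
- move=> j s' jn [sj st'].
  apply: (@wp_put_seq (1100 * (m * m * m))) => /=; first by lia.
  apply: wp_conseq (@step_try _ (Ordinal jn) _ _ _) _.
  + exact: step_upd st'.
  + by rewrite ?updE /= sj.
  move=> s3 [F3 st3]; split; first by rewrite F3 // ?updE.
  split; first by rewrite ?updE.
  apply: step_upd => //.
  have jn' : j < size (enum 'I_n) by rewrite size_enum_ord.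
  rewrite (take_nth (Ordinal jn)) // -rcons_cat.
  by rewrite [nth _ _ _](_ : _ = Ordinal jn) //; apply: val_inj; rewrite /= nth_enum_ord.
move=> s3 [_]; rewrite take_oversize ?size_enum_ord // => st3.
apply: (@wp_put_seq (100 * m)) => /=; first by lia.
have [F3 ek3 d3] := st3.
apply: (@wp_for (fun j s' => [/\ s' rv 0 = j, step (p1 ++ enum 'I_n) s',
   s' out =1 s3 out & s' rcnt 0 = \sum_(0 <= u < j) s3 out u]) n 20) => /=.
- by rewrite -/m; lia.
- split; [by rewrite ?updE | by do 2 apply: (step_upd) => // | by [] | by rewrite big_geq].
- by move=> j s' [sj [F _ _] _ _]; have [-> _] := loaded_frame F isT isT ls.
- move=> j s' jn [sj st' ed ec]; apply: wp_put => //=; split; first by rewrite ?updE.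
  split; [by rewrite ?updE | by do 2 apply: (step_upd) => // | by [] |].
  by rewrite ?updE /= ec ed sj big_nat_recr.
move=> s' [_ [F ek _] _ ->]; split=> //.
have -> : greedy G p1 = kept s3 by rewrite ek3.
(* The cells are 0 or 1, so their sum counts the vertices not kept. *)
rewrite big_mkord -sum1_card [RHS]big_mkcond /=.
apply: eq_bigr => u _; rewrite !inE; have := d3 u (ltn_ord u).
by case: (s3 out u) => [|[]].
Qed.
End Greedy.

(** * The search tree *)

(** The number of nodes of the complete [c]-ary tree of depth [d]. *)
Fixpoint tree_size (c d : nat) :=
  if d is d'.+1 then (c * tree_size c d').+1 else 1.

Lemma tree_size_gt0 c d : 0 < tree_size c d.
Proof. by case: d. Qed.

(** Each of the [d] levels below the root has at most [c ^ d] nodes. *)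
Lemma tree_size_le c d : tree_size c d <= 1 + d * c ^ d.
Proof.
elim: d => [|d IH] //=; rewrite add1n ltnS.
have /leq_trans -> // : c * tree_size c d <= c * (1 + d * c ^ d) by rewrite leq_mul2l IH orbT.
rewrite mulnDr muln1 mulnCA -expnS mulSn leq_add2r.
by case: c {IH} => // c; rewrite expnS leq_pmulr // expn_gt0.
Qed.

Definition append_cmd :=
  Seq (Put vert (Reg rtail) (Reg rv))
 (Seq (Put par (Reg rtail) (Reg rhead))
 (Seq (Put dep (Reg rtail) (Add (Get dep (Reg rhead)) (Lit 1)))
 (Seq (Put mark (Reg rv) (Lit 1))
      (SetReg rtail (Add (Reg rtail) (Lit 1)))))).

Definition expand_cmd := For rv N (If (Get out (Reg rv)) append_cmd Skip).

Definition next_cmd := SetReg rhead (Add (Reg rhead) (Lit 1)).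

(** A large oct ends the search by emptying the queue; [out] and [rcnt] retain it for the final
    output. *)
Definition step_cmd :=
  If (Sub (Get dep (Reg rhead)) (Add (Get 0 (Lit 0)) (Get 0 (Lit 0))))
     next_cmd
     (Seq greedy_cmd
     (If (Sub (Get 0 (Lit 1)) (Reg rcnt))
         (Seq expand_cmd next_cmd)
         (SetReg rhead (Reg rtail)))).

(** The output overwrites [q] and [k], which are not read any more at this point. *)
Definition unmarked_cmd :=
  Seq (For rv N (If (Get mark (Reg rv)) Skip (Put 0 (Lit 1) (Reg rv))))
      (Put 0 (Lit 0) (Lit 0)).

(** The initial zeros already encode the root as node 0. Nodes from [rhead] up to [rtail] form a
    queue, and after the loop [rcnt] tells the two outcomes apart. *)
Definition main_cmd :=
  Seq (SetReg rtail (Lit 1))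
 (Seq (While (Sub (Reg rtail) (Reg rhead)) step_cmd)
      (If (Sub (Get 0 (Lit 1)) (Reg rcnt)) unmarked_cmd (Put 0 (Lit 0) (Lit 1)))).

(** * Invariants and running time of the search *)

Section Main.
Variables (n : nat) (G : sgraph 'I_n).
Implicit Types (s : state) (p : seq 'I_n) (L : seq (seq 'I_n)).

Let m := n.+1.

Definition marked s : {set 'I_n} := [set v : 'I_n | s mark v != 0].

Definition children p (r : seq 'I_n) := [seq z :: p | z <- r & z \notin greedy G p].

Lemma size_children p : size (children p (enum 'I_n)) = #|~: greedy G p|.
Proof.
rewrite size_map cardE /enum_mem; congr size.
by rewrite -filter_predI; apply: eq_filter => z; rewrite !inE andbT.
Qed.

Lemma tree_rcons s s' L i (v : 'I_n) : tree s L -> i < size L ->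
  (forall a j, a \in [:: vert; par; dep] -> j < size L -> s' a j = s a j) ->
  s' vert (size L) = v -> s' par (size L) = i ->
  s' dep (size L) = (size (nth [::] L i)).+1 ->
  tree s' (rcons L (v :: nth [::] L i)).
Proof.
move=> [L0 Ld Lp] iL es' sv sp sd; split.
- by rewrite nth_rcons (leq_ltn_trans _ iL).
- move=> j; rewrite size_rcons nth_rcons ltS_eqVlt; case: (ltngtP j (size L)) => //= [jL _|-> _].
    by rewrite es' // Ld.
  by rewrite sd.
- move=> j; rewrite size_rcons !nth_rcons ltS_eqVlt andb_orr.
  case: (ltngtP j (size L)) => [jL|//|->]; rewrite ?andbF ?andbT //=.
    move=> j0; rewrite !es' //; have [pj [v' ev eL]] := Lp j ltac:(by rewrite j0).
    by split=> //; exists v' => //; rewrite (ltn_trans pj jL).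
  by move=> _; rewrite sp iL; split=> //; exists v.
Qed.

Definition expand_frame := [:: rv; vert; par; dep; mark; rtail].

Lemma wp_expand s L i p : loaded G s -> tree s L -> s rhead 0 = i -> i < size L ->
  nth [::] L i = p -> s rtail 0 = size L -> kept n s = greedy G p ->
  wp expand_cmd s (100 * m) (fun s' =>
    [/\ frame expand_frame s s', tree s' (L ++ children p (enum 'I_n)),
        s' rtail 0 = size (L ++ children p (enum 'I_n)) &
        marked s' = marked s :|: ~: greedy G p]).
Proof.
move=> ls tL si iL ep st ks.
pose C j := children p (take j (enum 'I_n)).
apply: (@wp_for (fun j s' => [/\ frame expand_frame s s', s' rv 0 = j,
    tree s' (L ++ C j), s' rtail 0 = size (L ++ C j) &
    marked s' = marked s :|: [set z in take j (enum 'I_n) | z \notin greedy G p]]) n 60) => /=.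
- by rewrite -/m; lia.
- have F : frame expand_frame s (upd s rv 0 0) by apply: frame_upd.
  split=> //; rewrite /C take0 ?cats0 //.
  by apply/setP => z; rewrite !inE orbF.
- by move=> j s' [F sj _ _ _]; have [-> _] := loaded_frame F isT isT ls.
- move=> j s' jn [F sj tL' st' mk].
  set v := Ordinal jn.
  have etake : take j.+1 (enum 'I_n) = rcons (take j (enum 'I_n)) v.
    rewrite (take_nth v) ?size_enum_ord //; congr rcons.
    by apply: val_inj; rewrite /= nth_enum_ord.
  have delv : (s' out j == 0) = (v \in greedy G p) by rewrite F // -ks inE.
  have iLC : i < size (L ++ C j) by rewrite size_cat ltn_addr.
  have epC : nth [::] (L ++ C j) i = p by rewrite nth_cat iL.
  have sh : s' rhead 0 = i by rewrite F.
  apply: (@wp_if 50) => //=; rewrite sj; last first.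
    move/eqP; rewrite delv => vg; apply: wp_skip => //; split=> //.
    have eC : C j.+1 = C j.
      by rewrite /C etake /children filter_rcons vg.
    rewrite eC; split=> //; first exact: frame_upd.
    rewrite -[LHS]/(marked s') mk; apply/setP => z; rewrite !inE etake mem_rcons inE.
    by case: (eqVneq z v) => //= ->; rewrite vg !andbF.
  rewrite delv => vg.
  have eC : L ++ C j.+1 = rcons (L ++ C j) (v :: p).
    by rewrite /C etake /children filter_rcons vg map_rcons -rcons_cat.
  apply: (@wp_put_seq 40) => //=; apply: (@wp_put_seq 30) => //=.
  apply: (@wp_put_seq 20) => //=; apply: (@wp_put_seq 10) => //=.
  apply: wp_put => //=; rewrite ?updE /= sj st' sh.
  split; first by rewrite ?updE.
  have dp : s' dep i = size (nth [::] (L ++ C j) i) by have [_ -> //] := tL'.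
  split=> //.
  + by do 6 apply: frame_upd => //.
  + rewrite eC -[in rcons _ _]epC; apply: (tree_rcons tL' iLC).
    * move=> a u; rewrite !inE => ha uL; rewrite !updE.
      have -> : (u == size (L ++ C j)) = false by rewrite ltn_eqF.
      by case/or3P: ha => /eqP ->.
    * by rewrite !updE /= eqxx.
    * by rewrite !updE /= eqxx.
    * by rewrite !updE /= eqxx dp addn1.
  + by rewrite eC size_rcons ?updE /= addn1.
  + have -> : marked s :|: [set z in take j.+1 (enum 'I_n) | z \notin greedy G p] =
        v |: marked s'.
      rewrite mk; apply/setP => z; rewrite !inE etake mem_rcons inE.
      by case: (eqVneq z v) => //= ->; rewrite vg orbT.
    apply/setP => z; rewrite !inE ?updE /=.
    have -> : (z == j :> nat) = (z == v) by [].
    by case: (z == v).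
- move=> s' [F _]; rewrite /C take_oversize ?size_enum_ord // => tL' st' mk.
  split=> //; rewrite mk; congr (_ :|: _); apply/setP => z.
  by rewrite !inE mem_enum.
Qed.

Variables (q k : nat).
Hypotheses (q0 : 0 < q) (k0 : 0 < k).

Let s0 := input q k G.
Let D := (2 * q).+1.

Hypothesis size_n : tree_size k.-1 D <= n.

Definition main_frame := rhead :: greedy_frame ++ expand_frame.

(** Bounds the nodes still to be processed, including those not yet created: a node of depth [d]
    accounts for a full subtree of depth [D - d]. *)
Definition potential L i := \sum_(p <- drop i L) tree_size k.-1 (D - size p).

Definition expanded s L p := #|~: greedy G p| < k /\
  {in ~: greedy G p, forall z, z :: p \in L /\ z \in marked s}.

(** [L] lists the nodes created so far, of which the first [i] have been processed. Each marked
    vertex is charged to a node other than the root, hence the strict bound in [run_marked]. *)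
Record running s L i : Prop := Running {
  run_frame : frame main_frame s0 s;
  run_tree : tree s L;
  run_tail : s rtail 0 = size L;
  run_head : s rhead 0 = i;
  run_le : i <= size L;
  run_cnt : s rcnt 0 < k;
  run_potential : i + potential L i <= tree_size k.-1 D;
  run_marked : #|marked s| < size L;
  run_expanded : forall j, j < i -> size (nth [::] L j) <= 2 * q ->
    expanded s L (nth [::] L j)
}.

Definition finished s := [/\ frame main_frame s0 s, s rhead 0 = s rtail 0,
  k <= s rcnt 0 & exists p, kept n s = greedy G p /\ s rcnt 0 = #|~: greedy G p|].

Lemma potentialS L i : i < size L ->
  potential L i = tree_size k.-1 (D - size (nth [::] L i)) + potential L i.+1.
Proof. by move=> iL; rewrite /potential (drop_nth [::] iL) big_cons. Qed.

Lemma size_le_potential L i : i <= size L -> size L <= i + potential L i.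
Proof.
move=> iL; rewrite -leq_subLR -size_drop /potential -sum1_size leq_sum // => p _.
exact: tree_size_gt0.
Qed.

(** If a child accounts for [t], the node gives up [1 + (k-1) t] and its at most [k-1] children
    claim at most [(k-1) t]. *)
Lemma potential_children L i : i < size L -> size (nth [::] L i) <= 2 * q ->
  #|~: greedy G (nth [::] L i)| < k ->
  potential (L ++ children (nth [::] L i) (enum 'I_n)) i.+1 < potential L i.
Proof.
move=> iL szp Zk; rewrite (potentialS iL) /potential drop_cat.
set p := nth [::] L i in szp Zk *; set c := k.-1.
have -> : D - size p = (2 * q - size p).+1 by rewrite /D subSn.
have eC : \sum_(r <- children p (enum 'I_n)) tree_size c (D - size r) =
    #|~: greedy G p| * tree_size c (2 * q - size p).
  transitivity (\sum_(r <- children p (enum 'I_n)) tree_size c (2 * q - size p)).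
    by apply: eq_big_seq => r /mapP [z _ ->].
  by rewrite big_const_seq count_predT iter_addn_0 mulnC size_children.
(* [drop_cat] splits into cases; for the last node of the queue the second branch is the same
   list. *)
have -> : (if i.+1 < size L then drop i.+1 L ++ children p (enum 'I_n)
    else drop (i.+1 - size L) (children p (enum 'I_n))) =
    drop i.+1 L ++ children p (enum 'I_n).
  case: ltnP => // Li; have -> : i.+1 - size L = 0 by lia.
  by rewrite drop0 drop_oversize.
rewrite big_cat /= eC addnC addSn ltnS leq_add2r leq_mul2r; apply/orP; right.
by rewrite /c; lia.
Qed.

Lemma loaded_main s : frame main_frame s0 s -> loaded G s.
Proof. by move=> F; apply: loaded_frame F _ _ _. Qed.

Lemma wp_step s L i : running s L i -> i < size L ->
  wp step_cmd s (5000 * (m * m * m * m)) (fun s' =>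
    (exists L' i', running s' L' i' /\ potential L' i' < potential L i) \/
    finished s').
Proof.
move=> R iL; have [F tL st sh _ sc po mk cl] := R.
have ls := loaded_main F.
have m4 : m <= m * m * m * m by rewrite /m; nia.
(* This bounds the walk to the root in [wp_greedy] by [n] rounds. *)
have Ln : size L <= n.
  by apply: leq_trans size_n; apply: leq_trans po; apply: size_le_potential; lia.
have dp : s dep i = size (nth [::] L i) by have [_ -> //] := tL.
have pi := potentialS iL.
have s00 : s 0 0 = q by rewrite F.
have gsub : {subset greedy_frame <= main_frame} by apply/allP.
have esub : {subset expand_frame <= main_frame} by apply/allP.
apply: (@wp_if (4900 * (m * m * m * m))) => /=; first by lia.
  rewrite sh dp s00 => szp; apply: wp_put => /=; first by lia.
  left; exists L, i.+1; split; last by rewrite pi; have := tree_size_gt0 k.-1 (D - size (nth [::] L i)); lia.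
  split=> //.
  - exact: frame_upd.
  - by rewrite updE /= sh addn1.
  - have := tree_size_gt0 k.-1 (D - size (nth [::] L i)); lia.
  - by move=> j; rewrite ltS_eqVlt => /predU1P [->|/cl //]; lia.
rewrite sh dp s00 => szp.
have {}szp : size (nth [::] L i) <= 2 * q by lia.
apply: (@wp_seq (4000 * (m * m * m * m)) (900 * (m * m * m * m))); first by lia.
have i_n : i <= n by lia.
apply: wp_conseq (wp_greedy ls tL sh iL i_n) _ => s1 [F1 ks cs].
have F01 : frame main_frame s0 s1 by apply: frame_trans F F1 _ _.
have s1k : s1 0 1 = k by rewrite F01.
apply: (@wp_if (800 * (m * m * m * m))) => /=; first by lia.
  rewrite s1k cs => Zk; have {}Zk : #|~: greedy G (nth [::] L i)| < k by lia.
  apply: (@wp_seq (100 * m) 20); first by rewrite /m; lia.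
  have tL1 : tree s1 L := tree_frame F1 isT isT isT tL.
  have st1 : s1 rtail 0 = size L by rewrite F1.
  have sh1 : s1 rhead 0 = i by rewrite F1.
  apply: wp_conseq (wp_expand (loaded_main F01) tL1 sh1 iL erefl st1 ks) _.
  move=> s2 [F2 tL2 st2 mk2].
  have F02 : frame main_frame s0 s2 by apply: frame_trans F01 F2 _ _.
  have mk1 : marked s1 = marked s.
    by apply/setP => z; rewrite !inE F1.
  have po2 := potential_children iL szp Zk.
  apply: wp_put => //=; left; exists (L ++ children (nth [::] L i) (enum 'I_n)), i.+1.
  split=> //; split=> //.
  - exact: frame_upd.
  - by rewrite updE /= F2 // sh1 addn1.
  - by rewrite size_cat; lia.
  - by rewrite updE /= F2 // cs.
  - by move: po po2; lia.
  - rewrite -[marked _]/(marked s2) mk2 mk1 size_cat size_children.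
    by have := cardsU (marked s) (~: greedy G (nth [::] L i)); lia.
  - move=> j ji; have jL : j < size L by lia.
    rewrite nth_cat jL; move: ji; rewrite ltS_eqVlt => /predU1P [-> _|ji szj].
      split=> // z zZ; rewrite mem_cat -[marked _]/(marked s2) mk2 in_setU zZ orbT.
      split=> //; apply/orP; right; apply: map_f.
      by rewrite mem_filter mem_enum andbT; move: zZ; rewrite inE.
    have [jk jc] := cl j ji szj; split=> // z /jc [zL zm].
    by rewrite mem_cat zL -[marked _]/(marked s2) mk2 mk1 in_setU zm.
rewrite s1k => ck; apply: wp_put => /=; first by lia.
right; split.
- exact: frame_upd.
- by rewrite !updE.
- by rewrite updE /=; lia.
- by exists (nth [::] L i).
Qed.

Lemma running_start : running (upd s0 rtail 0 1) [:: [::]] 0.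
Proof.
split=> //.
- exact: frame_upd.
- by split=> // -[|j] //; rewrite ltnS ltn0.
- by rewrite /potential big_cons big_nil addn0 subn0.
- by rewrite (_ : marked _ = set0) ?cards0.
Qed.

Lemma wp_unmarked s L : running s L (size L) ->
  wp unmarked_cmd s (100 * m) (fun s' => s' 0 0 = 0 /\
    exists2 v : 'I_n, s' 0 1 = v & v \notin marked s).
Proof.
move=> [F tL st sh _ sc po mk cl].
have ls := loaded_main F.
(* Fewer vertices are marked than there are nodes, and there are at most [n] nodes. *)
have [v0 v0m] : exists v0, v0 \notin marked s.
  have : ~~ ([set: 'I_n] \subset marked s).
    apply/negP => /subset_leq_card; rewrite cardsT card_ord leqNgt => /negP; apply.
    by apply: leq_trans size_n; apply: leq_trans po; apply: leq_trans mk (leq_addr _ _).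
  by case/subsetPn => v _; exists v.
apply: (@wp_seq (100 * m - 10) 10); first by rewrite /m; lia.
(* [v0] guarantees that a vertex gets written; the one returned is the last unmarked vertex. *)
apply: (@wp_for (fun j s' => [/\ s' 0 2 = n, s' rv 0 = j, s' mark =1 s mark &
  v0 < j -> exists2 v : 'I_n, s' 0 1 = v & v \notin marked s]) n 40) => /=.
- by rewrite -/m; lia.
- by case: ls => sn _; split; rewrite ?updE.
- by move=> j s' [sn sj _ _].
- move=> j s' jn [sn sj em Hv]; apply: (@wp_if 20) => //=.
    rewrite sj em => mj; apply: wp_skip => //; split=> //; split=> //.
    rewrite ltS_eqVlt => /predU1P [ej|/Hv //].
    by case/negP: v0m; rewrite inE ej.
  rewrite sj em => mj; apply: wp_put => //=; split; first by rewrite ?updE.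
  split; rewrite ?updE //.
  by move=> _; exists (Ordinal jn); rewrite ?inE ?updE /= ?sj ?mj.
- move=> s' [_ _ _ /(_ (ltn_ord v0)) [v sv vm]]; apply: wp_put => //.
  by split; rewrite ?updE //; exists v.
Qed.

Lemma wp_main : unbreakable G q (2 * k) ->
  wp main_cmd s0 (3 * m * (5000 * (m * m * m * m))) (fun s =>
    (exists Z : {set 'I_n}, [/\ returns_set s Z, minimal_oct G Z & k <= #|Z|]) \/
    (exists v : 'I_n, returns_vertex s v /\ irrelevant G k v)).
Proof.
move=> unbr.
have m4 : m <= m * m * m * m by rewrite /m; nia.
set B := 5000 * (m * m * m * m).
have mB : 5000 * m <= B by rewrite leq_mul2l m4 orbT.
apply: (@wp_put_seq (3 * m * B - 10)) => /=; first by rewrite /m in mB *; nia.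
apply: (@wp_seq (2 * m * B) (m * B - 10)); first by rewrite /m in mB *; nia.
(* The variant bounds the potential, which is at most [tree_size k.-1 D <= n] at the start. *)
apply: (@wp_while (fun u s => (exists L i, running s L i /\ potential L i <= u) \/
  finished s) B n) => /=.
- by rewrite -/m; rewrite /m in mB *; nia.
- left; exists [:: [::]], 0; split; first exact: running_start.
  by have := run_potential running_start; rewrite add0n => /leq_trans; apply.
- move=> u s [[L [i [R pu]]]|[_ -> _ _]]; last by rewrite subnn.
  rewrite (run_tail R) (run_head R) subn_eq0 -ltnNge => iL.
  have u0 : 0 < u.
    by apply: leq_trans pu; rewrite potentialS //; have := tree_size_gt0 k.-1 (D - size (nth [::] L i)); lia.
  exists u.-1; first by lia.
  apply: wp_conseq (wp_step R iL) _ => s' [[L' [i' [R' pp]]]|fin]; last by right.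
  by left; exists L', i'; split=> //; lia.
move=> u s [[L [i [R _]]]|fin] e.
  have eL : i = size L.
    by move/eqP: e; have := run_le R; rewrite (run_tail R) (run_head R); lia.
  rewrite {}eL in R *.
  have F := run_frame R.
  apply: (@wp_if (100 * m)); first by rewrite /=; rewrite /m in mB *; nia.
    move=> _; apply: wp_conseq (wp_unmarked R) _ => s' [s'0 [v s'1 vm]].
    right; exists v; split; first by [].
    apply: (untouched_irrelevant (L := L) unbr).
      have [L0 _ _] := run_tree R; rewrite -L0 mem_nth //.
      exact: leq_ltn_trans (run_marked R).
    (* The queue is exhausted, so every node of [L] has been processed; were [v] outside [greedy p],
       it would be marked. *)
    move=> p pL szp; have ep := nth_index [::] pL.
    have := run_expanded R (j := index p L); rewrite ep index_mem => /(_ pL szp) [pk pc].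
    split=> // [|z /pc [] //]; apply: contraR vm => vp.
    by have [|//] := pc v; rewrite inE.
  rewrite /= (F 0) // => e'; have := run_cnt R; rewrite -subn_gt0.
  by rewrite [k - _]e'.
have [F _ kc [p [ks cs]]] := fin.
apply: (@wp_if 10) => /=; first by rewrite /m in mB *; nia.
  by rewrite (F 0) //= -/k; lia.
move=> _; apply: wp_put => //=; left; exists (~: greedy G p); split.
- split; first by rewrite ?updE.
  by apply/setP => z; rewrite -ks !inE ?updE.
- exact: greedy_minimal_oct.
- by rewrite -cs.
Qed.

End Main.

(** * The explicit bounds *)

Theorem theorem6 :
  exists (p : cmd) (C a b : nat),
    forall (q k n : nat) (G : sgraph 'I_n),
      1 <= q -> 1 <= k ->
      unbreakable G q (2 * k) ->
      (2 * q + 2) ^ 2 * (2 * q + 2)`! * (k - 1) ^ (2 * q + 2) + 1 <= n ->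
      exists (t : nat) (s : state),
        [/\ exec p (input q k G) t s,
            t <= C * (q * k) ^ (a * q) * n ^ b &
            (exists Z : {set 'I_n},
               [/\ returns_set s Z, minimal_oct G Z & k <= #|Z|]) \/
            (exists v : 'I_n, returns_vertex s v /\ irrelevant G k v)].
Proof.
(* The lower bound on [n] absorbs the size of the tree, whence [a = 0]. The power [n ^ 5] comes from
   at most [n] nodes, linearly many tests for each, and cubic time per test; [2 ^ 5] pays for
   [n.+1 <= 2 n]. *)
exists main_cmd, (3 * 5000 * 2 ^ 5), 0, 5 => q k n G q0 k0 unbr n_large.
have size_n : tree_size k.-1 (2 * q).+1 <= n.
  apply: leq_trans n_large; rewrite subn1 addn1 -add1n.
  apply: leq_trans (tree_size_le _ _) _; rewrite leq_add2l; set c := k.-1.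
  have fact_gt : 0 < (2 * q + 2)`! := fact_gt0 _.
  (* The factorial is at least 1. Then [2q + 1 <= (2q + 2)^2], and raising the exponent by one does
     not lower the power of [c]; for [c = 0] both powers vanish. *)
  apply: (@leq_trans ((2 * q + 2) ^ 2 * c ^ (2 * q + 2))); last first.
    by rewrite leq_mul2r; apply/orP; right; rewrite leq_pmulr.
  apply: leq_mul; first by rewrite -mulnn; nia.
  rewrite (_ : 2 * q + 2 = ((2 * q).+1).+1); last by lia.
  by case: c => [|c]; [rewrite !exp0n | rewrite leq_pexp2l].
have [t [s [Hs ts res]]] := wp_main q0 k0 size_n unbr.
exists t, s; split=> //; apply: leq_trans ts _.
have n0 : 0 < n by apply: leq_trans size_n; apply: tree_size_gt0.
have n5 : n.+1 * (n.+1 * n.+1 * n.+1 * n.+1) <= 2 ^ 5 * n ^ 5.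
  rewrite -expnMn (_ : n.+1 * _ = n.+1 ^ 5); last by rewrite !expnS expn0 muln1 !mulnA.
  by rewrite leq_exp2r //; lia.
move: 5000 => c; rewrite mul0n expn0 muln1.
have -> : 3 * n.+1 * (c * (n.+1 * n.+1 * n.+1 * n.+1)) =
    3 * c * (n.+1 * (n.+1 * n.+1 * n.+1 * n.+1)) by rewrite !mulnA; lia.
by rewrite -(mulnA (3 * c)) leq_mul2l n5 orbT.
Qed.
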